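(* For every natural number $n$ there exists a constant $C$ with the following property: whenever $M$ is a subgroup of $\mathrm{GL}_n(\mathbb{C})$ containing a normal subgroup $\Gamma$ of finite index with $\Gamma \cong \mathbb{Z}$, and $c_M$ denotes the smallest index of an abelian subgroup of the finite group $M/\Gamma$, we have $c_M < C$. *)

(* Defs.v *)
From HB Require Import structures.
From mathcomp Require Import all_boot all_order all_algebra.
From mathcomp Require Import complex.
From mathcomp Require Import reals Rstruct.
Set Implicit Arguments. Unset Strict Implicit. Unset Printing Implicit Defensive.
Import Order.TTheory GRing.Theory Num.Theory.
Local Open Scope ring_scope.

Definition CC : Type := complex Rdefinitions.R.

Definition cmat (n : nat) : Type := 'M[CC]_n.

Definition mset (n : nat) := cmat n -> Prop.

Definition is_GL_subgroup (n : nat) (G : mset n) : Prop :=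
  [/\ G 1%:M,
      (forall g, G g -> g \in unitmx),
      (forall g h, G g -> G h -> G (g *m h)) &
      (forall g, G g -> G (invmx g))].

Definition subset_of (n : nat) (A B : mset n) : Prop := forall g, A g -> B g.

Definition is_subgroup_of (n : nat) (H G : mset n) : Prop :=
  is_GL_subgroup H /\ subset_of H G.

Definition is_normal_in (n : nat) (N G : mset n) : Prop :=
  is_subgroup_of N G /\
  (forall g h, G g -> N h -> N (invmx g *m h *m g)).

Definition iso_to_Z (n : nat) (N : mset n) : Prop :=
  exists f : int -> cmat n,
    [/\ (forall a b : int, f (a + b)%R = f a *m f b),
        (forall a, N (f a)),
        (forall a b, f a = f b -> a = b) &
        (forall g, N g -> exists a, f a = g)].

Definition has_index (n : nat) (G H : mset n) (k : nat) : Prop :=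
  exists g : 'I_k -> cmat n,
    (forall i, G (g i)) /\
    (forall x, G x -> exists! i, H (invmx (g i) *m x)).

Definition finite_index (n : nat) (G H : mset n) : Prop :=
  exists k, has_index G H k.

(* Subgroups of the quotient G/N, via the correspondence theorem: a
   subgroup of G/N is H/N for a unique subgroup H with N <= H <= G.
   H/N is abelian iff all commutators of H lie in N, and
   [G/N : H/N] = [G : H]. *)
Definition abelian_mod (n : nat) (H N : mset n) : Prop :=
  forall x y, H x -> H y -> N (invmx x *m invmx y *m x *m y).

Definition quot_has_abelian_subgroup_of_index
  (n : nat) (G N : mset n) (k : nat) : Prop :=
  exists H : mset n,
    [/\ is_subgroup_of H G, subset_of N H, abelian_mod H N & has_index G H k].

(* Main.v *)
(* Let t generate Gamma. The centralizer G of t has index at most 2 in M. The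
   transfer into the central subgroup Gamma is a homomorphism phi : G -> Z with
   phi(t) = k = [G : Gamma]. As a matrix over C, t has a k-th root r that is a
   polynomial in t, hence commutes with G, and x |-> x r^(-phi x) is a homomorphism
   with finite image whose kernel is central; moreover x and y commute as soon as
   their images do. The image is conjugate to a finite unitary group, where
   Frobenius' form of Jordan's argument applies: elements at distance less than
   1/2 from the identity commute pairwise, and by a packing bound depending only on
   n, among boundedly many elements of G some two have a quotient with such an image.
   So the double centralizer in G of the elements with small image is abelian and of
   bounded index in M. *)
Require Import Defs.
From mathcomp Require Import all_boot all_order all_algebra.
From mathcomp Require Import complex boolp reals Rstruct spectral sesquilinear ring lra zify.
Set Implicit Arguments.
Unset Strict Implicit.
Unset Printing Implicit Defensive.
Import Order.TTheory GRing.Theory Num.Theory.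
Local Open Scope ring_scope.

(** * Subgroups of units, coset colourings and the transfer *)

(** Phrased in a unit ring so that ring lemmas apply; over ['M[CC]_n.+1] it is convertible to
    [is_GL_subgroup]. *)
Definition unit_subgroup (R : unitRingType) (G : R -> Prop) :=
  [/\ G 1, (forall x, G x -> x \is a GRing.unit),
      (forall x y, G x -> G y -> G (x * y)) & (forall x, G x -> G x^-1)].

Definition transversal (R : unitRingType) (G H : R -> Prop) k (g : 'I_k -> R) :=
  (forall i, G (g i)) /\ (forall x, G x -> exists! i, H ((g i)^-1 * x)).

(** Elements in distinct left cosets of [H] have distinct colours, so a maximal family of them has
    at most [#|T|] members, and by maximality it meets every coset. Index bounds below are all
    obtained from such colourings. *)
Lemma coloring_transversal (R : unitRingType) (G H : R -> Prop) (T : finType)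
    (c : R -> T) :
    unit_subgroup G -> unit_subgroup H ->
    (forall x y, G x -> G y -> c x = c y -> H (x^-1 * y)) ->
  exists k, (k <= #|T|)%N /\ exists g : 'I_k -> R, transversal G H g.
Proof.
move=> [_ GU _ _] [H1 _ HM HV] cH.
have HVM x y : G x -> G y -> H (x^-1 * y) -> H (y^-1 * x).
  by move=> Gx Gy /HV; rewrite invrM ?unitrV ?GU // invrK.
pose indep k := exists g : 'I_k -> R,
  (forall i, G (g i)) /\ forall i j, H ((g i)^-1 * g j) -> i = j.
have ex0 : exists k, `[< indep k >].
  by exists 0; apply/asboolP; exists (fun=> 1); split=> -[].
have le_indep k : `[< indep k >] -> (k <= #|T|)%N.
  move=> /asboolP[g [gG gI]]; rewrite -(card_ord k).
  by apply: (leq_card (c \o g)) => i j /= /cH gij; apply: gI; apply: gij.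
case: (ex_maxnP ex0 le_indep) => k /[dup] /le_indep kT /asboolP[g [gG gI]] kmax.
exists k; split=> //; exists g; split=> // x Gx.
have [i Hi] : exists i, H ((g i)^-1 * x).
  apply: contrapT => noi; have /kmax : `[< indep k.+1 >]; last by rewrite ltnn.
  apply/asboolP; exists (fun i => oapp g x (unlift ord_max i)); split.
    by move=> i; case: (unliftP ord_max i) => [j _|_] /=; [apply: gG|].
  move=> i j; case: (unliftP ord_max i) => [i' ->|->];
    case: (unliftP ord_max j) => [j' ->|->] //=.
  - by move/gI ->.
  - by move=> Hx; case: noi; exists i'.
  - by move=> Hx; case: noi; exists j'; apply: HVM.
exists i; split=> // j Hj; apply: gI.
have := HM _ _ Hi (HVM _ _ (gG j) Gx Hj).
by rewrite mulrA -(mulrA (g i)^-1) divrr ?GU // mulr1.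
Qed.

(** Write [x * g i = g j * t ^ a]; then [phi x] is the sum over [i] of the exponents [a]. Left
    multiplication permutes the cosets, which gives additivity, and a factor [t ^ a] shifts each of
    the [k] exponents by [a]. *)
Lemma transfer_central_cyclic (R : unitRingType) (G : R -> Prop) (t : R) k
    (g : 'I_k -> R) :
    unit_subgroup G -> G t -> injective (exprz t) ->
    (forall x, G x -> GRing.comm x t) ->
    transversal G (fun x => exists a : int, x = t ^ a) g ->
  exists phi : R -> int,
    (forall x y, G x -> G y -> phi (x * y) = phi x + phi y) /\
    (forall x (a : int), G x -> phi (x * t ^ a) = phi x + a *+ k).
Proof.
move=> [G1 GU GM GV] tG tI Gt [gG gT]; have tU := GU _ tG.
have Gta x (a : int) : G x -> t ^ a * x = x * t ^ a.
  move=> Gx; have xt m := commrX m (Gt _ Gx).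
  by apply/esym; case: a => m; [apply: xt | apply: commrV; apply: xt].
have repU i j (a b : int) : g i * t ^ a = g j * t ^ b -> i = j /\ a = b.
  move=> gij; have ij : i = j.
    have [l [_ lU]] := gT _ (gG j).
    have <- : l = i; [apply: lU | by apply: lU; exists 0; rewrite mulVr ?GU].
    exists (a - b); rewrite exprzDr // -(mulKr (GU _ (gG i)) (t ^ a)) gij.
    by rewrite -!mulrA -exprzDr // subrr mulr1.
  split=> //; apply: tI; move: gij; rewrite ij => /(congr1 ( *%R (g j)^-1)).
  by rewrite !mulKr ?GU.
(* [choice] requires a total function, so arguments outside [G] receive the arbitrary value
   [(p.2, 0)]. *)
have repE (p : R * 'I_k) : exists q : 'I_k * int,
    G p.1 -> p.1 * g p.2 = g q.1 * t ^ q.2.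
  have [Gx|nG] := pselect (G p.1); last by exists (p.2, 0).
  have [j [[a ja] _]] := gT _ (GM _ _ Gx (gG p.2)).
  by exists (j, a) => _ /=; rewrite -ja mulVKr ?GU.
have [F FE] := choice repE.
(* Cocycle rule: [y] acts on the index first, then [x], and the exponents add. *)
have FM x y i : G x -> G y ->
    F (x * y, i) = ((F (x, (F (y, i)).1)).1, (F (x, (F (y, i)).1)).2 + (F (y, i)).2).
  move=> Gx Gy; have xy := FE (x * y, i) (GM _ _ Gx Gy); move: xy => /=.
  rewrite -mulrA (FE (y, i) Gy) mulrA (FE (x, _) Gx) /= -mulrA -exprzDr //.
  by move=> /repU[e1 e2]; rewrite [LHS]surjective_pairing -e1 -e2.
exists (fun x => \sum_i (F (x, i)).2); split=> [x y Gx Gy|x a Gx].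
  have inj : injective (fun i => (F (y, i)).1).
    move=> i j /= Fij; have := FE (y, j) Gy; have := FE (y, i) Gy; rewrite /= Fij.
    move=> yi yj; apply: (repU _ _ (- (F (y, i)).2) (- (F (y, j)).2) _).1.
    apply: (mulrI (GU _ Gy)); rewrite !mulrA yi yj -!mulrA -!exprzDr //.
    by rewrite !subrr.
  rewrite [X in _ = X + _](reindex_inj inj) /= -big_split /=.
  by apply: eq_bigr => i _; rewrite FM.
have tE i : (F (x * t ^ a, i)).2 = (F (x, i)).2 + a.
  have Gtm m : G (t ^+ m) by elim: m => // m IH; rewrite exprS; apply: GM.
  have Gt' : G (t ^ a) by case: a => m; [apply: Gtm | apply/GV/Gtm].
  have := FE (x * t ^ a, i) (GM _ _ Gx Gt') => /=.
  by rewrite -mulrA Gta // mulrA (FE (x, i) Gx) -mulrA -exprzDr // => /repU[].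
by rewrite (eq_bigr _ (fun i _ => tE i)) big_split /= sumr_const card_ord.
Qed.

(** * The Frobenius norm *)

Local Open Scope sesquilinear_scope.

(** This is the square of the Frobenius norm, so the bound [4^-1] below means distance less than
    1/2. *)
Definition frob {C : numClosedFieldType} m n (A : 'M[C]_(m, n)) : C :=
  \sum_i \sum_j `|A i j| ^+ 2.

Lemma frobE (C : numClosedFieldType) m n (A : 'M[C]_(m, n)) :
  frob A = \tr (A *m A ^t*).
Proof.
rewrite /mxtrace; apply: eq_bigr => i _; rewrite mxE; apply: eq_bigr => j _.
by rewrite !mxE normCK.
Qed.

Lemma frob_ge0 (C : numClosedFieldType) m n (A : 'M[C]_(m, n)) : 0 <= frob A.
Proof. by apply: sumr_ge0 => i _; apply: sumr_ge0 => j _; rewrite exprn_ge0. Qed.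

Lemma frob_eq0 (C : numClosedFieldType) m n (A : 'M[C]_(m, n)) :
  (frob A == 0) = (A == 0).
Proof.
apply/eqP/eqP => [|->]; last first.
  by rewrite /frob big1 // => i _; rewrite big1 // => j _; rewrite mxE normr0 expr0n.
move=> A0; apply/matrixP => i j; rewrite mxE; apply/eqP.
have /psumr_eq0P -/(_ _ i isT) : frob A = 0 by [].
move=> /(_ (fun i _ => sumr_ge0 _ (fun j _ => exprn_ge0 2 (normr_ge0 (A i j))))).
move=> /psumr_eq0P -/(_ _ j isT).
move=> /(_ (fun j _ => exprn_ge0 2 (normr_ge0 (A i j)))) /eqP.
by rewrite sqrf_eq0 normr_eq0.
Qed.

Lemma adj_mul (C : numClosedFieldType) m n p (A : 'M[C]_(m, n)) (B : 'M[C]_(n, p)) :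
  (A *m B) ^t* = B ^t* *m A ^t*.
Proof. by rewrite trmx_mul map_mxM. Qed.

Lemma frobMr (C : numClosedFieldType) m n (A : 'M[C]_(m, n)) (U : 'M[C]_n) :
  U \is unitarymx -> frob (A *m U) = frob A.
Proof.
move=> /unitarymxP UU; rewrite !frobE adj_mul mulmxA -(mulmxA A) UU mulmx1 //.
Qed.

Lemma frobMl (C : numClosedFieldType) m n (A : 'M[C]_(m, n)) (U : 'M[C]_m) :
  U \is unitarymx -> frob (U *m A) = frob A.
Proof.
rewrite -trmxC_unitary => /unitarymxP; rewrite trmxCK => UU.
by rewrite !frobE adj_mul mxtrace_mulC mulmxA -(mulmxA _ _ U) UU mulmx1 mxtrace_mulC.
Qed.

(** Cauchy-Schwarz for each entry, seen as the product of a row of [A] and a column of [B]. *)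
Lemma frob_mul_le (C : numClosedFieldType) m n p
    (A : 'M[C]_(m, n)) (B : 'M[C]_(n, p)) : frob (A *m B) <= frob A * frob B.
Proof.
rewrite /frob mulr_suml; apply: ler_sum => i _.
rewrite [X in _ * X]exchange_big mulr_sumr /=; apply: ler_sum => j _.
have dotE (u v : 'rV[C]_n) : dotmx u v = \sum_k u 0 k * (v 0 k)^*.
  by rewrite dotmxE mxE; apply: eq_bigr => k _; rewrite !mxE.
pose u := row i A; pose v := (col j B) ^t*.
have : `|dotmx u v| ^+ 2 <= dotmx u u * dotmx v v := CauchySchwarz (@dotmx C n) u v.
rewrite !dotE /u /v; congr (_ <= _).
  congr (`|_| ^+ 2); rewrite mxE; apply: eq_bigr => k _.
  by rewrite !mxE conjCK.
by congr (_ * _); apply: eq_bigr => k _; rewrite !mxE ?conjCK normCK // mulrC.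
Qed.

(** The parallelogram law entry by entry; it serves as triangle inequality for squared norms. *)
Lemma frobB_le (C : numClosedFieldType) m n (A B : 'M[C]_(m, n)) :
  frob (A - B) <= 2 * frob A + 2 * frob B.
Proof.
rewrite /frob !mulr_sumr -big_split; apply: ler_sum => i _ /=.
rewrite !mulr_sumr -big_split; apply: ler_sum => j _ /=; rewrite !mxE.
set a := A i j; set b := B i j.
have -> : 2 * `|a| ^+ 2 + 2 * `|b| ^+ 2 = `|a - b| ^+ 2 + `|a + b| ^+ 2.
  by rewrite !normCK rmorphB rmorphD /= -![2]/(1 + 1); ring.
by rewrite lerDl exprn_ge0.
Qed.

(** * Commutation of unitary matrices close to the identity *)

Lemma unitary_dot (C : numClosedFieldType) n (U : 'M[C]_n) (u v : 'rV[C]_n) :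
  U \is unitarymx -> (u *m U) *m (v *m U) ^t* = u *m v ^t*.
Proof. by move=> UU; rewrite adj_mul mulmxA mulmxtVK. Qed.

(** [A] preserves the Hermitian form, so [b * b^* = 1]; a nonzero product of [u] and [v] would also
    give [a * b^* = 1], hence [a = b]. *)
Lemma unitary_eigen_orthogonal (C : numClosedFieldType) n (A : 'M[C]_n)
    (u v : 'rV[C]_n) (a b : C) :
  A \is unitarymx -> v != 0 -> u *m A = a *: u -> v *m A = b *: v -> a != b ->
  u *m v ^t* = 0.
Proof.
move=> AU v0 uA vA ab; apply/eqP; apply: contraNT ab => uv0; apply/eqP.
have bb : b * b^* = 1.
  have := unitary_dot v v AU; rewrite vA => /(congr1 mxtrace).
  rewrite linearZ/= map_mxZ /= -scalemxAl -scalemxAr scalerA linearZ /= -frobE.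
  by move=> H; apply: (mulIf (_ : frob v != 0)); rewrite ?frob_eq0 // mul1r.
have := unitary_dot u v AU; rewrite uA vA linearZ/= map_mxZ /=.
rewrite -scalemxAl -scalemxAr scalerA => H.
have ab1 : a * b^* = 1.
  apply/eqP; rewrite -subr_eq0; apply/eqP.
  have : (a * b^* - 1) *: (u *m v ^t*) = 0 by rewrite scalerBl H scale1r subrr.
  by move/eqP; rewrite scaler_eq0 (negPf uv0) orbF => /eqP.
have b0 : b^* != 0 by apply: contra_eq_neq bb => ->; rewrite mulr0 eq_sym oner_eq0.
by apply: (mulIf b0); rewrite ab1 bb.
Qed.

Lemma unitary_normal (C : numClosedFieldType) n (A : 'M[C]_n) :
  A \is unitarymx -> A ^t* *m A = 1%:M.
Proof. by rewrite -trmxC_unitary => /unitarymxP; rewrite trmxCK. Qed.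

(** The eigenspace of [D] is stable under [A], and [A] has an eigenvector inside it because the
    field is closed. *)
Lemma common_eigenvector_in (C : numClosedFieldType) n (A D : 'M[C]_n) mu :
    A *m D = D *m A -> eigenvalue D mu ->
  exists a, exists v : 'rV[C]_n, [/\ v != 0, v *m A = a *: v & v *m D = mu *: v].
Proof.
move=> AD /negPf muD; pose W := row_base (eigenspace D mu).
have WA : (W *m A <= W)%MS.
  rewrite /W -/(stablemx _ _) stablemx_row_base.
  by apply: comm_mx_stable_eigenspace; rewrite /comm_mx.
have [w wA] := submxP WA.
have [a] := eigenvalue_closed w ltac:(by rewrite lt0n mxrank_eq0 muD).
case/eigenvalueP => u uw u0; exists a, (u *m W); split.
- by rewrite mulmx_free_eq0 ?row_base_free.
- by rewrite -mulmxA wA mulmxA uw -scalemxAl.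
- by apply/eigenspaceP; rewrite (submx_trans (submxMl _ _)) // eq_row_base.
Qed.

Lemma normal_neq0_eigenvalue (C : numClosedFieldType) n (D : 'M[C]_n) :
  D \is normalmx -> D != 0 -> exists2 mu, mu != 0 & eigenvalue D mu.
Proof.
move=> /orthomx_spectralP DE D0.
set P := spectralmx D in DE; set d := spectral_diag D in DE.
have Pu : P \in unitmx by apply: spectral_unit.
have : d != 0 by apply: contra_neq D0 => d0; rewrite DE d0 raddf0 mulmx0 mul0mx.
case/rV0Pn => i di; exists (d 0 i) => //; apply/eigenvalueP; exists (row i P).
  rewrite {1}DE -row_mul !mulmxA mulmxV // mul1mx mul_diag_mx.
  by apply/rowP => j; rewrite !mxE.
apply: contraTneq Pu => Pi0; rewrite -row_free_unit; apply/negP => /row_freeP[Q PQ].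
have /(congr1 (fun M : 'M_n => M i i)) := PQ.
rewrite !mxE eqxx big1; first by move/eqP; rewrite eq_sym oner_eq0.
by move=> j _; move/rowP: Pi0 => /(_ j); rewrite !mxE => ->; rewrite mul0r.
Qed.

(* A nonzero B A B^-1 - A would be normal and commute with A, so some w satisfies
   w A = a w and w (B A B^-1) = b w with a <> b; then w B is a b-eigenvector of A,
   hence orthogonal to w, and |w B - w|^2 = 2 |w|^2. *)
Lemma comm_conj_unitary (C : numClosedFieldType) n (A B : 'M[C]_n) :
    A \is unitarymx -> B \is unitarymx -> frob (B - 1%:M) < 2 ->
    A *m (B *m A *m B ^t*) = B *m A *m B ^t* *m A ->
  A *m B = B *m A.
Proof.
move=> AU BU B1; set A' := B *m A *m B ^t* => AA'.
have BK := unitary_normal BU; have BK' := unitarymxP BU.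
have A'U : A' \is unitarymx by rewrite !mul_unitarymx ?trmxC_unitary.
have A'B : A' *m B = B *m A by rewrite /A' -mulmxA BK mulmx1.
have [/eqP|D0] := boolP (A' - A == 0).
  by move/subr0_eq=> A'A; rewrite -A'B A'A.
clearbody A'.
have Dn : A' - A \is normalmx.
  apply/normalmxP; rewrite linearB/= map_mxB /= !(mulmxBl, mulmxBr).
  rewrite !(unitarymxP _) // !unitary_normal //.
  have AtA' : A ^t* *m A' = A' *m A ^t*.
    rewrite -[LHS]mulmx1 -(unitarymxP AU) mulmxA -(mulmxA _ A') -AA'.
    by rewrite !mulmxA unitary_normal // mul1mx.
  have A'tA : A' ^t* *m A = A *m A' ^t*.
    rewrite -[LHS]mulmx1 -(unitarymxP A'U) mulmxA -(mulmxA _ A) AA'.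
    by rewrite !mulmxA unitary_normal // mul1mx.
  by rewrite AtA' A'tA !opprB addrACA [RHS]addrACA; congr (_ + _); rewrite addrC.
have [mu mu0 Dmu] := normal_neq0_eigenvalue Dn D0.
have AD : A *m (A' - A) = (A' - A) *m A by rewrite mulmxBr mulmxBl AA'.
have [a [w [w0 wA wD]]] := common_eigenvector_in AD Dmu.
have wA' : w *m A' = (a + mu) *: w.
  by rewrite scalerDl -wD mulmxBr wA addrCA subrr addr0.
have wBA : (w *m B) *m A = (a + mu) *: (w *m B).
  by rewrite -mulmxA -A'B mulmxA wA' -scalemxAl.
have wB0 : w *m B != 0 by rewrite -frob_eq0 frobMr // frob_eq0.
have amu : a != a + mu by rewrite -subr_eq0 opprD addrA subrr sub0r oppr_eq0.
have o1 := unitary_eigen_orthogonal AU wB0 wA wBA amu.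
have o2 : (w *m B) *m w ^t* = 0.
  by rewrite -[LHS]trmxCK adj_mul trmxCK o1 linear0 map_mx0.
have wnear : frob (w *m (B - 1%:M)) = 2 * frob w.
  rewrite !frobE mulmxBr mulmx1 linearB/= map_mxB /= mulmxBl !mulmxBr o1 o2.
  by rewrite sub0r subr0 opprK unitary_dot // mxtraceD mulr_natl mulr2n.
have : 2 * frob w < 2 * frob w.
  rewrite -{1}wnear (le_lt_trans (frob_mul_le _ _)) // mulrC ltr_pM2r //.
  by rewrite lt_def frob_eq0 w0 frob_ge0.
by rewrite ltxx.
Qed.

(** Up to a unitary factor the left side is [A *m B - B *m A], which is unchanged when 1 is
    subtracted from both [A] and [B]. The constant 4 is the sum of the two factors 2 in
    [frobB_le]. *)
Lemma frob_commutator_le (C : numClosedFieldType) n (A B : 'M[C]_n) :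
    A \is unitarymx -> B \is unitarymx ->
  frob (A *m B *m A ^t* *m B ^t* - 1%:M) <=
    4 * (frob (A - 1%:M) * frob (B - 1%:M)).
Proof.
move=> AU BU.
have -> : A *m B *m A ^t* *m B ^t* - 1%:M = (A *m B - B *m A) *m (A ^t* *m B ^t*).
  by rewrite mulmxBl !mulmxA -(mulmxA B A) !(unitarymxP _) // mulmx1 (unitarymxP _).
rewrite frobMr ?mul_unitarymx ?trmxC_unitary //.
have -> : A *m B - B *m A =
    (A - 1%:M) *m (B - 1%:M) - (B - 1%:M) *m (A - 1%:M).
  rewrite !(mulmxBl, mulmxBr) !(mulmx1, mul1mx) !opprB.
  rewrite [RHS]addrACA [X in _ = X]addrAC; apply/matrixP => i j; rewrite !mxE; ring.
apply: le_trans (frobB_le _ _) _; rewrite -mulrDr -[4]/((2 * 2)%:R) natrM -mulrA.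
rewrite ler_pM2l ?ltr0n // mulr2n mulrDl !mul1r lerD ?frob_mul_le //.
by rewrite [leRHS]mulrC frob_mul_le.
Qed.

(** Induction on the number of members of [s] closer to 1 than [B]. Since [4 * frob (A - 1%:M) < 1],
    the commutator of [A] and [B] is strictly closer to 1 than [B], so it commutes with [A] by
    induction; then [comm_conj_unitary] applies. *)
Lemma small_unitary_comm (C : numClosedFieldType) n (s : seq 'M[C]_n) :
    {in s, forall A, A \is unitarymx} ->
    {in s &, forall A B, A *m B \in s} ->
    {in s, forall A, A ^t* \in s} ->
  {in [pred A in s | frob (A - 1%:M) < 4^-1] &, forall A B, A *m B = B *m A}.
Proof.
move=> sU sM sV A B /andP[sA A4] /andP[sB B4].
have [m] := ubnP (count (fun D => frob (D - 1%:M) < frob (B - 1%:M)) s).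
elim: m B sB B4 => // m IH B sB B4 /ltnSE Bm.
have [AU BU] := (sU _ sA, sU _ sB).
have [/eqP|B1] := boolP (frob (B - 1%:M) == 0).
  move/eqP; rewrite frob_eq0 => /eqP /subr0_eq ->.
  by rewrite mulmx1 mul1mx.
apply: comm_conj_unitary => //.
  apply: (lt_trans B4); apply: (@lt_trans _ _ 1); last by rewrite ltr1n.
  by rewrite invf_lt1 ?ltr0n // ltr1n.
set K := A *m B *m A ^t* *m B ^t*.
have KB : frob (K - 1%:M) < frob (B - 1%:M).
  apply: le_lt_trans (frob_commutator_le AU BU) _.
  rewrite mulrA -[X in _ < X]mul1r ltr_pM2r; last by rewrite lt_def B1 frob_ge0.
  by rewrite mulrC -ltr_pdivlMr ?ltr0n // div1r.
have sK : K \in s by rewrite !sM ?sV.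
have AK : A *m K = K *m A.
  apply: IH => //; first exact: lt_trans KB B4.
  apply: leq_trans Bm; rewrite !(permP (perm_to_rem sK)) /= ltxx KB.
  by rewrite add0n add1n ltnS sub_count // => D /= /lt_trans; apply.
(* Cancelling [A] shows that it commutes with the conjugate of its inverse; taking adjoints then
   gives the conjugate of [A] itself. *)
have AX : A *m (B *m A ^t* *m B ^t*) = B *m A ^t* *m B ^t* *m A.
  have /(congr1 (mulmx (A ^t*))) := AK.
  by rewrite /K !mulmxA unitary_normal // !mul1mx.
have := congr1 (fun M => M ^t*) AX; rewrite !adj_mul !trmxCK mulmxA => XA.
have /(congr1 (fun M => A *m M *m A)) := XA.
by rewrite !mulmxA (unitarymxP AU) mul1mx -[_ *m _ *m A]mulmxA unitary_normal // mulmx1.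
Qed.

(** * Conjugating a finite matrix group into the unitary group *)

(** In a unitary eigenbasis [P] is diagonal with positive entries; take their square roots. *)
Lemma positive_hermitian_factor (C : numClosedFieldType) n (P : 'M[C]_n) :
    P ^t* = P -> (forall v : 'rV[C]_n, v != 0 -> 0 < \tr (v *m P *m v ^t*)) ->
  exists2 Q : 'M[C]_n, Q \in unitmx & Q *m Q ^t* = P.
Proof.
move=> PH Ppos.
have /orthomx_spectralP : P \is normalmx by apply/normalmxP; rewrite PH.
set U := spectralmx P; set d := spectral_diag P => PE.
have UU : U \is unitarymx by apply: spectral_unitarymx.
rewrite invmx_unitary // in PE.
have dpos i : 0 < d 0 i.
  have Ui : row i U != 0.
    by apply: contraTneq UU => Ui; apply/negP => /row_unitarymxP/(_ i i);
      rewrite Ui dotmxE mul0mx mxE eqxx => /eqP; rewrite eq_sym oner_eq0.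
  have := Ppos _ Ui; congr (0 < _).
  have -> : \tr (row i U *m P *m (row i U) ^t*) = (U *m P *m U ^t*) i i.
    rewrite -row_mul /mxtrace big_ord1 mxE [RHS]mxE.
    by apply: eq_bigr => k _; rewrite [row _ _ _ _]mxE; congr (_ * _); rewrite !mxE.
  by rewrite PE !mulmxA (unitarymxP UU) mul1mx -mulmxA (unitarymxP UU) mulmx1
    mxE eqxx mulr1n.
exists (U ^t* *m diag_mx (\row_i sqrtC (d 0 i))).
  rewrite unitmx_mul unitarymx_unit ?trmxC_unitary //= unitmxE det_diag unitfE.
  by apply/prodf_neq0 => i _; rewrite mxE sqrtC_eq0 gt_eqF.
rewrite adj_mul trmxCK [RHS]PE !mulmxA; congr (_ *m _).
rewrite -mulmxA tr_diag_mx map_diag_mx mulmx_diag; congr (_ *m diag_mx _).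
apply/rowP => i; rewrite !mxE -normCK ger0_norm ?sqrtC_ge0 ?ltW //.
by rewrite sqrtCK.
Qed.

(** The sum [P] of all [A *m A ^t*] is an invariant form, since left multiplication permutes [s].
    Writing [P = Q *m Q ^t*] turns invariance under [A] into unitarity of the conjugate by [Q]. *)
Lemma unitarizable (C : numClosedFieldType) n (s : seq 'M[C]_n) :
    uniq s -> 1%:M \in s -> {in s, forall A, A \in unitmx} ->
    {in s &, forall A B, A *m B \in s} ->
  exists2 Q : 'M[C]_n, Q \in unitmx &
    {in s, forall A, invmx Q *m A *m Q \is unitarymx}.
Proof.
move=> us s1 sU sM; pose P := \sum_(A <- s) A *m A ^t*.
have Pinv : {in s, forall A, A *m P *m A ^t* = P}.
  move=> A sA; rewrite mulmx_sumr mulmx_suml.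
  have inj : injective (mulmx A : 'M[C]_n -> 'M[C]_n).
    by move=> X Y AXY; rewrite -(mulKmx (sU _ sA) X) AXY mulKmx ?sU.
  have perm_As : perm_eq (map (mulmx A) s) s.
    have umap : uniq (map (mulmx A) s) by rewrite map_inj_uniq.
    have sub : {subset map (mulmx A) s <= s} by move=> _ /mapP[X sX ->]; apply: sM.
    have szle : (size s <= size (map (mulmx A) s))%N by rewrite size_map.
    by have [_ eqs] := uniq_min_size umap sub szle; apply: uniq_perm.
  rewrite /P -[RHS](perm_big _ perm_As) big_map.
  by apply: eq_bigr => X _; rewrite adj_mul !mulmxA.
have [] := @positive_hermitian_factor C n P.
- rewrite /P linear_sum map_mx_sum; apply: eq_bigr => A _.
  by rewrite adj_mul trmxCK.
- move=> v v0; have -> : v *m P *m v ^t* = \sum_(A <- s) (v *m A) *m (v *m A) ^t*.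
    rewrite mulmx_sumr mulmx_suml; apply: eq_bigr => A _.
    by rewrite adj_mul !mulmxA.
  (* The summand of the identity already contributes [frob v], which makes the form definite. *)
  rewrite raddf_sum /= (big_rem _ s1) /= mulmx1 -frobE ltr_wpDr //.
    by apply: sumr_ge0 => A _; rewrite -frobE frob_ge0.
  by rewrite lt_def frob_eq0 v0 frob_ge0.
move=> Q QU QP; exists Q => // A sA; apply/unitarymxP.
rewrite !adj_mul !mulmxA -(mulmxA _ Q) QP -(mulmxA _ A) -(mulmxA _ (A *m P)).
rewrite Pinv // -QP -!mulmxA -adj_mul mulVmx //.
by rewrite mulKmx // trmx1 map_mx1.
Qed.

(** * Roots of an invertible matrix that are polynomials in it *)

Lemma exprD_mod_sqr (R : comNzRingType) (a b : R) m :
  exists t, (a + b) ^+ m = a ^+ m + m%:R * a ^+ m.-1 * b + b ^+ 2 * t.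
Proof.
elim: m => [|m [t IH]]; first by exists 0; rewrite !expr0; ring.
exists (m%:R * a ^+ m.-1 + t * (a + b)).
rewrite exprS IH; case: m {IH} => [|m] /=; rewrite ?expr0 ?expr1 ?exprS.
  by ring.
by rewrite -!natr1; ring.
Qed.

(* Hensel lifting, one linear factor at a time; characteristic 0 handles the
   case of a repeated root. *)
Lemma Xroot_mod_prod (C : numClosedFieldType) m (rs : seq C) :
  (0 < m)%N -> 0 \notin rs ->
  exists p : {poly C}, \prod_(r <- rs) ('X - r%:P) %| p ^+ m - 'X.
Proof.
move=> m0; elim: rs => [|r rs IH]; first by exists 0; rewrite big_nil dvd1p.
rewrite in_cons negb_or eq_sym => /andP[r0 /IH[p /dvdpP[s qs]]].
set q := \prod_(j <- rs) _ in qs *.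
have step c : exists2 S : {poly C}, (p + q * c%:P) ^+ m - 'X = q * S &
    q.[r] = 0 -> S.[r] = s.[r] + m%:R * p.[r] ^+ m.-1 * c.
  have [t ->] := exprD_mod_sqr p (q * c%:P) m.
  exists (s + m%:R * p ^+ m.-1 * c%:P + q * (c ^+ 2)%:P * t).
    have -> : p ^+ m = s * q + 'X by rewrite -qs subrK.
    by rewrite rmorphXn /=; ring.
  move=> qr; rewrite !hornerD !hornerM qr !mul0r addr0 !hornerE.
  by rewrite -[m%:R]polyC_natr hornerC.
suff [c Sc] : exists c, forall S, (p + q * c%:P) ^+ m - 'X = q * S ->
    (q.[r] = 0 -> S.[r] = s.[r] + m%:R * p.[r] ^+ m.-1 * c) -> root S r.
  have [S ES Sr] := step c; exists (p + q * c%:P); rewrite ES big_cons mulrC.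
  by rewrite dvdp_mul // dvdp_XsubCl; apply: Sc.
have [qr|qr] := eqVneq q.[r] 0.
  have pr : p.[r] ^+ m = r.
    have /(congr1 (horner^~ r)) := qs.
    by rewrite !hornerE qr mulr0 => /eqP; rewrite subr_eq0 => /eqP.
  have pr0 : p.[r] != 0.
    by apply: contra_neq r0 => pr0; rewrite -pr pr0 expr0n gtn_eqF.
  (* Newton correction: this [c] solves the linear equation [S.[r] = 0]. *)
  exists (- s.[r] / (m%:R * p.[r] ^+ m.-1)) => S _ /(_ qr); rewrite /root => ->.
  by rewrite mulrC divfK ?subrr // mulf_neq0 ?expf_neq0 // pnatr_eq0 -lt0n.
(* At a new root [c] is chosen so that the corrected polynomial takes the value [m.-root r] at
   [r]. *)
exists ((m.-root r - p.[r]) / q.[r]) => S /(congr1 (horner^~ r)).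
rewrite hornerD hornerN hornerX horner_exp hornerD !hornerM hornerC.
rewrite [X in p.[r] + X]mulrC divfK // subrKC rootCK // subrr => /eqP.
by rewrite eq_sym mulf_eq0 (negPf qr).
Qed.

(** If the characteristic polynomial of [g] divides [p ^+ m - 'X], then by Cayley-Hamilton [p]
    evaluated at [g] is an [m]-th root. *)
Lemma commuting_mxroot (C : numClosedFieldType) n (g : 'M[C]_n.+1) m :
    (0 < m)%N -> g \in unitmx ->
  exists2 r : 'M[C]_n.+1, r ^+ m = g & forall x, GRing.comm x g -> GRing.comm x r.
Proof.
move=> m0 gU; have [rs rsE] := closed_field_poly_normal (char_poly g).
rewrite (monicP (char_poly_monic g)) scale1r in rsE.
have rs0 : 0 \notin rs.
  rewrite -root_prod_XsubC -rsE -eigenvalue_root_char.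
  apply/negP => /eigenvalueP[v /eqP]; rewrite scale0r => /eqP vg.
  by rewrite -[v](mulmxK gU) vg mul0mx eqxx.
have [p /dvdpP[s ps]] := Xroot_mod_prod m0 rs0.
exists (horner_mx g p).
  apply/eqP; rewrite -subr_eq0 -rmorphXn /= -[X in _ - X]horner_mx_X -rmorphB ps.
  by rewrite rmorphM /= -rsE Cayley_Hamilton mulr0.
by move=> x xg; apply: comm_mx_horner.
Qed.

(** * A packing bound for the unitary group *)

Lemma unitary_entry_le1 (C : numClosedFieldType) n (A : 'M[C]_n) i j :
  A \is unitarymx -> `|A i j| ^+ 2 <= 1.
Proof.
move=> /unitarymxP /matrixP/(_ i i); rewrite !mxE eqxx mulr1n => <-.
rewrite (bigD1 j) //= !mxE -normCK lerDl; apply: sumr_ge0 => k _.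
by rewrite !mxE -normCK exprn_ge0.
Qed.

Lemma sqr_normcE (R : rcfType) (z : complex R) :
  `|z| ^+ 2 = real_complex R (complex.Re z ^+ 2 + complex.Im z ^+ 2).
Proof. by rewrite add_Re2_Im2. Qed.

Lemma trunc_grid (R : archiRealFieldType) N (x y : R) : (0 < N)%N ->
    x ^+ 2 <= 1 -> y ^+ 2 <= 1 ->
    inord (Num.truncn ((x + 1) * N%:R)) =
      inord (Num.truncn ((y + 1) * N%:R)) :> 'I_(N.*2.+1) ->
  (y - x) ^+ 2 <= N%:R ^- 2.
Proof.
move=> N0 x1 y1; have NR : 0 < N%:R :> R by rewrite ltr0n.
(* The cell numbers run from 0 to [2 * N] inclusive, the last one reached at [z = 1]; so [inord]
   never falls back on its default. *)
have bound (z : R) : z ^+ 2 <= 1 -> 0 <= (z + 1) * N%:R /\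
    (Num.truncn ((z + 1) * N%:R) < N.*2.+1)%N.
  move=> z1; have [zm zp] : -1 <= z /\ z <= 1 by split; nra.
  have z0 : 0 <= (z + 1) * N%:R by nra.
  split=> //; rewrite ltnS -(ler_nat R); have /andP[tz _] := truncn_itv z0; apply: le_trans tz _.
  by rewrite -muln2 natrM; nra.
have [x0 xN] := bound _ x1; have [y0 yN] := bound _ y1.
move=> /(congr1 (@nat_of_ord _)); rewrite !inordK // => xy.
have /andP[] := truncn_itv x0; have /andP[] := truncn_itv y0; rewrite -xy.
set k := Num.truncn _; rewrite -natr1 => y2 y3 x2 x3.
have [d1 d2] : -1 <= (y - x) * N%:R /\ (y - x) * N%:R <= 1 by split; lra.
rewrite -[leRHS]div1r ler_pdivlMr ?exprn_gt0 // -exprMn.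
by rewrite expr2; nra.
Qed.

Lemma unitary_coloring n : exists (T : finType) (c : 'M[CC]_n -> T),
  {in unitarymx &, forall A B, c A = c B -> frob (A ^t* *m B - 1%:M) < 4^-1}.
Proof.
(* Each entry of [B - A] has squared modulus at most [2 / N ^ 2], so the total is below 1/4 as soon
   as [8 * n ^ 2 < N ^ 2]. *)
pose N := (3 * n.+1)%N.
pose box (x : Rdefinitions.R) : 'I_(N.*2.+1) := inord (Num.truncn ((x + 1) * N%:R)).
exists {ffun 'I_n * 'I_n -> 'I_(N.*2.+1) * 'I_(N.*2.+1)}.
exists (fun A => [ffun p => (box (complex.Re (A p.1 p.2)), box (complex.Im (A p.1 p.2)))]).
move=> A B AU BU cAB.
have -> : A ^t* *m B - 1%:M = A ^t* *m (B - A).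
  by rewrite mulmxBr unitary_normal.
rewrite frobMl ?trmxC_unitary //.
pose e : CC := real_complex _ (2 * N%:R ^- 2).
have entry i j : `|(B - A) i j| ^+ 2 <= e.
  have := congr1 (fun f : {ffun _} => f (i, j)) cAB; rewrite !ffunE /= => -[cRe cIm].
  have le1 (M : 'M[CC]_n) : M \is unitarymx ->
      complex.Re (M i j) ^+ 2 <= 1 /\ complex.Im (M i j) ^+ 2 <= 1.
    move=> MU; have := unitary_entry_le1 i j MU; rewrite sqr_normcE.
    rewrite (lecR _ 1) => H.
    by split; apply: le_trans H; rewrite ?lerDl ?lerDr sqr_ge0.
  have [[A1 A2] [B1 B2]] := (le1 A AU, le1 B BU).
  have HRe := trunc_grid (isT : (0 < N)%N) A1 B1 cRe.
  have HIm := trunc_grid (isT : (0 < N)%N) A2 B2 cIm.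
  rewrite sqr_normcE lecR !mxE mulr_natl mulr2n.
  by move: HRe HIm; case: (A i j) (B i j) => [a b] [c d] /=; apply: lerD.
apply: le_lt_trans (_ : \sum_(i < n) \sum_(j < n) e < _).
  by apply: ler_sum => i _; apply: ler_sum => j _.
have -> : \sum_(i < n) \sum_(j < n) e = real_complex _ (2 * N%:R ^- 2 *+ n *+ n).
  by rewrite !sumr_const !card_ord !raddfMn.
rewrite [X in _ < X](_ : _ = real_complex _ 4^-1); last by rewrite fmorphV rmorph_nat.
rewrite ltcR -!mulrnAl ltr_pdivrMr ?exprn_gt0 ?ltr0n // mulrC.
rewrite ltr_pdivlMr ?ltr0n // -!natrX -!mulrnA -!natrM ltr_nat /N.
by nia.
Qed.

(** * From a central cyclic subgroup to a finite unitary image *)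

Lemma finite_unitary_twist (C : numClosedFieldType) n (G : 'M[C]_n.+1 -> Prop)
    (t : 'M[C]_n.+1) k (g : 'I_k -> 'M[C]_n.+1) :
    unit_subgroup G -> G t -> injective (exprz t) ->
    (forall x, G x -> GRing.comm x t) ->
    transversal G (fun x => exists a : int, x = exprz t a) g ->
  exists U : 'M[C]_n.+1 -> 'M[C]_n.+1,
  [/\ (forall x y, G x -> G y -> U (x * y) = U x * U y),
      (forall x, G x -> U x \is unitarymx),
      (forall x y, G x -> G y -> GRing.comm (U x) (U y) -> GRing.comm x y) &
      exists s : seq 'M[C]_n.+1, forall A, A \in s <-> exists2 x, G x & A = U x].
Proof.
move=> GG tG tI Gt gT; have [G1 GU GM GV] := GG; have [gG gU] := gT.
have [phi [phiM phit]] := transfer_central_cyclic GG tG tI Gt gT.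
have k0 : (0 < k)%N by have [i _] := gU _ G1; apply: leq_ltn_trans (ltn_ord i).
have [r rk rC] := commuting_mxroot k0 (GU _ tG).
have rU : r \is a GRing.unit by rewrite -(unitrX_pos _ k0) rk; apply: GU.
have rzC x (a : int) : GRing.comm x r -> GRing.comm x (exprz r a).
  by move=> xr; case: a => m; [|apply: commrV]; apply: commrX.
have Gr x a : G x -> GRing.comm x (exprz r a) by move=> Gx; apply: rzC; apply: rC; apply: Gt.
have rr a b : GRing.comm (exprz r a) (exprz r b).
  by apply: (rzC); apply: commr_sym; apply: rzC.
pose psi x := x * exprz r (- phi x).
have psiM x y : G x -> G y -> psi (x * y) = psi x * psi y.
  move=> Gx Gy; rewrite /psi phiM // opprD exprzDr //.
  by rewrite -!mulrA; congr (x * _); rewrite !mulrA (Gr y).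
have psiK x : psi x * exprz r (phi x) = x.
  by rewrite /psi -mulrA -exprzDr // addNr mulr1.
have psi_comm x y : G x -> G y -> GRing.comm (psi x) (psi y) -> GRing.comm x y.
  move=> Gx Gy xy; rewrite -(psiK x) -(psiK y).
  have pr z a : G z -> GRing.comm (psi z) (exprz r a).
    by move=> Gz; apply: commr_sym; apply: commrM; [apply: commr_sym; apply: Gr|apply: rr].
  apply: commrM; apply: commr_sym; apply: commrM; [exact: commr_sym|exact: pr| |exact: rr].
  by apply: commr_sym; apply: pr.
(* As [t = r ^+ k] and [phi] grows by [a *+ k], the twist cancels [t ^ a]; hence the image of [psi]
   is finite, given by the coset representatives. *)
have psit x a : G x -> psi (x * exprz t a) = psi x.
  have rka : exprz t a = exprz r (a *+ k).
    by rewrite -rk -[r ^+ k]/(exprz r k%:Z) exprz_exp -mulr_natl natz.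
  move=> Gx; rewrite /psi phit // -mulrA rka -exprzDr //.
  by congr (_ * exprz _ _); rewrite opprD addrCA subrr addr0.
have psiU x : G x -> psi x \is a GRing.unit.
  by move=> Gx; rewrite /psi unitrMl ?unitrXz //; apply: GU.
pose s := undup [seq psi (g i) | i <- enum 'I_k].
have us : uniq s by apply: undup_uniq.
have sE A : A \in s <-> exists2 x, G x & A = psi x.
  rewrite mem_undup; split=> [/mapP[i _ ->]|[x Gx ->]]; first by exists (g i).
  have [i [[a xa] _]] := gU _ Gx; apply/mapP; exists i; rewrite ?mem_enum //.
  by rewrite -[x](mulVKr (GU _ (gG i))) xa psit.
have psi1 : psi 1 = 1.
  by apply: (mulrI (psiU _ G1)); rewrite -psiM // !mulr1.
clearbody s psi; have [] := @unitarizable C n.+1 s.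
- exact: us.
- by apply/sE; exists 1; rewrite ?psi1.
- by move=> A /sE[x Gx ->]; apply: psiU.
- by move=> A B /sE[x Gx ->] /sE[y Gy ->]; apply/sE; exists (x * y); rewrite ?psiM //; apply: GM.
move=> Q QU sQ; exists (fun x => Q^-1 * psi x * Q); split.
- by move=> x y Gx Gy; rewrite psiM // !mulrA mulrK.
- by move=> x Gx; apply: sQ; apply/sE; exists x.
- move=> x y Gx Gy; rewrite /GRing.comm !mulrA !(mulrK QU) => /(mulIr QU).
  have QVU : Q^-1 \is a GRing.unit by rewrite unitrV.
  by rewrite -!mulrA => /(mulrI QVU) xy; apply: psi_comm.
- exists [seq Q^-1 * A * Q | A <- s] => A; split.
    by move=> /mapP[B /sE[x Gx ->] ->]; exists x.
  by move=> [x Gx ->]; apply/map_f/sE; exists x.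
Qed.

(** The twist [U] varies with [G], but the colours [T] of the unitary group do not: [x] is coloured
    by [c (U x)], and [S] collects the elements whose image is near 1. *)
Lemma commuting_coloring (C : numClosedFieldType) n (T : Type)
    (c : 'M[C]_n.+1 -> T) (G : 'M[C]_n.+1 -> Prop) (t : 'M[C]_n.+1) k
    (g : 'I_k -> 'M[C]_n.+1) :
    {in unitarymx &, forall A B, c A = c B -> frob (A ^t* *m B - 1%:M) < 4^-1} ->
    unit_subgroup G -> G t -> injective (exprz t) ->
    (forall x, G x -> GRing.comm x t) ->
    transversal G (fun x => exists a : int, x = exprz t a) g ->
  exists (c' : 'M[C]_n.+1 -> T) (S : 'M[C]_n.+1 -> Prop),
  [/\ (forall x, S x -> G x), (forall x y, S x -> S y -> GRing.comm x y) &
      forall x y, G x -> G y -> c' x = c' y -> S (x^-1 * y)].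
Proof.
move=> cP GG tG tI Gt gT.
have [U [UM UU U_comm [s sE]]] := finite_unitary_twist GG tG tI Gt gT.
have [G1 GU GM GV] := GG.
have U1 : U 1 = 1.
  have UU1 := unitarymx_unit (UU _ G1).
  by apply: (mulrI UU1); rewrite -UM // !mulr1.
have UV x : G x -> U x^-1 = (U x) ^t*.
  move=> Gx; rewrite -invmx_unitary ?UU //.
  apply: (mulrI (unitarymx_unit (UU _ Gx))); rewrite -UM; [|by []|exact: GV].
  transitivity (1 : 'M[C]_n.+1); last by rewrite [RHS]mulmxV // unitarymx_unit ?UU.
  by rewrite -U1; congr U; apply: mulrV; apply: GU.
exists (c \o U), (fun x => G x /\ frob (U x - 1%:M) < 4^-1); split.
- by move=> x [].
- move=> x y [Gx Ux] [Gy Uy]; apply: U_comm => //.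
  apply: (@small_unitary_comm _ _ s); rewrite ?inE.
  + by move=> A /sE[z Gz ->]; apply: UU.
  + by move=> A B /sE[z Gz ->] /sE[w Gw ->]; apply/sE; exists (z * w);
      rewrite ?UM //; apply: GM.
  + by move=> A /sE[z Gz ->]; apply/sE; exists z^-1; rewrite ?UV //; apply: GV.
  + by apply/andP; split=> //; apply/sE; exists x.
  + by apply/andP; split=> //; apply/sE; exists y.
- move=> x y Gx Gy /= cxy; split; first by apply: GM => //; apply: GV.
  by rewrite UM ?UV //; [apply: cP => //; apply: UU|apply: GV].
Qed.

(** * Centralizers, towers and the final assembly *)

Lemma centralizer_subgroup (R : unitRingType) (G S : R -> Prop) :
  unit_subgroup G -> unit_subgroup (fun x => G x /\ forall z, S z -> GRing.comm z x).
Proof.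
move=> [G1 GU GM GV]; split.
- by split=> // z _; apply: commr1.
- by move=> x [/GU].
- move=> x y [Gx Sx] [Gy Sy]; split; first exact: GM.
  by move=> z Sz; apply: commrM; [apply: Sx|apply: Sy].
- by move=> x [Gx Sx]; split; [apply: GV|move=> z Sz; apply: commrV; apply: Sx].
Qed.

Lemma exprz_intertwine (R : unitRingType) (x s t : R) (a : int) :
    s \is a GRing.unit -> t \is a GRing.unit ->
  x * t = s * x -> x * exprz t a = exprz s a * x.
Proof.
move=> sU tU xt; have xtm m : x * t ^+ m = s ^+ m * x.
  by elim: m => [|m IH]; rewrite ?mulr1 ?mul1r // !exprS mulrA xt -!mulrA IH.
case: a => m; first exact: xtm.
apply: (mulrI (unitrX m.+1 sU)); rewrite mulrA -xtm /exprz.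
by rewrite mulrK ?mulVKr ?unitrX.
Qed.

(** Conjugations by [x] and by its inverse raise [t] to powers [a] and [b] with [a * b = 1] in
    [int], so [a] is 1 or -1. *)
Lemma stable_cyclic_conj_sign (R : unitRingType) (x t : R) :
    x \is a GRing.unit -> t \is a GRing.unit -> injective (exprz t) ->
    (exists a : int, x * t * x^-1 = exprz t a) ->
    (exists a : int, x^-1 * t * x = exprz t a) ->
  x * t = t * x \/ x * t = t^-1 * x.
Proof.
move=> xU tU tI [a xa] [b xb].
have xt : x * t = exprz t a * x by rewrite -xa mulrVK.
have tb : x * exprz t b = t * x by rewrite -xb !mulrA divrr // mul1r.
have ab : a * b = 1.
  apply: tI; rewrite expr1z; apply: (mulIr xU); rewrite -tb -exprz_exp.
  by apply/esym/exprz_intertwine; rewrite ?unitrXz.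
have : (a == 1) || (a == -1).
  have : (`|a|%N * `|b|%N == 1)%N by rewrite -abszM ab.
  by rewrite muln_eq1 => /andP[/eqP a1 _]; lia.
by case/orP => /eqP aE; [left|right]; rewrite xt aE ?expr1z // exprN1.
Qed.

(** The colour records whether [x] fixes [t] or inverts it; elements of equal colour conjugate [t]
    to the same element. *)
Lemma centralizer_coloring (R : unitRingType) (M : R -> Prop) (t : R) :
    unit_subgroup M -> t \is a GRing.unit -> injective (exprz t) ->
    (forall x, M x -> exists a : int, x^-1 * t * x = exprz t a) ->
  exists b : R -> bool, forall x y, M x -> M y -> b x = b y ->
    GRing.comm (x^-1 * y) t.
Proof.
move=> [_ MU _ MV] tU tI Mt; exists (fun x => x * t == t * x) => x y Mx My bxy.
have sign z : M z -> z * t = t * z \/ z * t = t^-1 * z.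
  move=> Mz; apply: stable_cyclic_conj_sign => //; [exact: MU | | exact: Mt].
  by have := Mt _ (MV _ Mz); rewrite invrK.
have [s xs ys] : exists2 s, x * t = s * x & y * t = s * y.
  case: (sign x Mx) (sign y My) bxy => [xt|xt] [yt|yt] bxy.
  - by exists t.
  - by exists t => //; apply/eqP; rewrite -bxy xt.
  - by exists t => //; apply/eqP; rewrite bxy yt.
  - by exists t^-1.
have xVs : x^-1 * s = t * x^-1.
  by apply: (mulIr (MU _ Mx)); rewrite mulrVK ?MU // -mulrA -xs mulKr ?MU.
by rewrite /GRing.comm -mulrA ys mulrA xVs mulrA.
Qed.

(** [S] is commutative, so it lies in its centralizer [Z]. An element of the centralizer [H] of [Z]
    thus commutes with [S], so it lies in [Z] and commutes with all of [H]. *)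
Lemma abelian_double_centralizer (R : unitRingType) (G S : R -> Prop) :
    unit_subgroup G -> (forall x, S x -> G x) ->
    (forall x y, S x -> S y -> GRing.comm x y) ->
  exists H : R -> Prop,
  [/\ unit_subgroup H, (forall x, H x -> G x), (forall x, S x -> H x),
      (forall x, G x -> (forall y, G y -> GRing.comm y x) -> H x) &
      forall x y, H x -> H y -> GRing.comm x y].
Proof.
move=> GG SG SS; pose Z x := G x /\ forall z, S z -> GRing.comm z x.
exists (fun x => G x /\ forall z, Z z -> GRing.comm z x); split.
- exact: centralizer_subgroup.
- by move=> x [].
- by move=> x Sx; split=> [|z [_ Zz]]; [apply: SG|apply/commr_sym/Zz].
- by move=> x Gx xC; split=> // z [Gz _]; apply: xC.
- move=> x y [Gx Hx] [Gy Hy]; apply: Hy; split=> // z Sz.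
  by apply: Hx; split; [apply: SG|move=> w Sw; apply: SS].
Qed.

(** Multiplicativity of the index for colourings: [x] is translated into [G] by a chosen element [w]
    of its own colour and then coloured by [c]. *)
Lemma tower_coloring (R : unitRingType) (M G H : R -> Prop) (B T : Type)
    (b : R -> B) (c : R -> T) :
    unit_subgroup M ->
    (forall x y, M x -> M y -> b x = b y -> G (x^-1 * y)) ->
    (forall x y, G x -> G y -> c x = c y -> H (x^-1 * y)) ->
  exists d : R -> B * T, forall x y, M x -> M y -> d x = d y -> H (x^-1 * y).
Proof.
move=> [_ MU _ _] bG cH.
have /choice[w wP] e : exists v, forall x, M x -> b x = e -> M v /\ b v = e.
  have [[v [Mv bv]]|no] := pselect (exists v, M v /\ b v = e); first by exists v.
  by exists 1 => x Mx bx; case: no; exists x.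
exists (fun x => (b x, c ((w (b x))^-1 * x))) => x y Mx My [bxy].
have [Mw bw] := wP _ _ Mx erefl; rewrite -bxy => cxy.
have := cH _ _ (bG _ _ Mw Mx bw) (bG _ _ Mw My (etrans bw bxy)) cxy.
by rewrite invrM ?unitrV ?MU // invrK -mulrA mulVKr ?MU.
Qed.

(* c_M < C  <->  M/Gamma has an abelian subgroup of index k with k < C
   (c_M being the least such index). *)
Theorem theorem3p5 :
  forall n : nat, exists C : nat,
    forall (M Gamma : mset n),
      is_GL_subgroup M ->
      is_normal_in Gamma M ->
      finite_index M Gamma ->
      iso_to_Z Gamma ->
      exists k : nat,
        quot_has_abelian_subgroup_of_index M Gamma k /\ (k < C)%N.
Proof.
case=> [|n].
  (* There is only one matrix of size 0, so no injection of [int] exists. *)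
  exists 0 => M Gamma _ _ _ [f [_ _ fI _]].
  by have /fI : f 0 = f 1 by apply/matrixP => -[].
have [T [c cP]] := unitary_coloring n.+1.
(* [bool] accounts for the centralizer of [t], [T] for the grid of unitary matrices; the successor
   makes the bound strict. *)
exists (#|{: bool * T}|).+1 => M Gamma MM [[GammaG GammaM] Gammanorm] [m [h hM]].
move=> [f [fD fGamma fI fS]].
have MG : unit_subgroup M := MM; have GG : unit_subgroup Gamma := GammaG.
have [M1 MU MMul MV] := MG; have [G1 GU GM GV] := GG.
pose t := f 1; have Gt : Gamma t by apply: fGamma.
have tU : t \is a GRing.unit by apply: GU.
have f0 : f 0 = 1.
  have f0U : f 0 \is a GRing.unit by apply: GU.
  by apply: (mulrI f0U); rewrite mulr1; have := fD 0 0; rewrite addr0.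
have fX m' : f (Posz m') = t ^+ m'.
  by elim: m' => [|m' IH]; rewrite ?f0 // exprS -IH -[Posz m'.+1]/(1 + Posz m') fD.
have fE a : f a = exprz t a.
  case: a => m' //; rewrite NegzE.
  have tmU : t ^+ m'.+1 \is a GRing.unit by apply: unitrX.
  apply: (mulrI tmU); rewrite [RHS]divrr // -fX.
  by have := fD (Posz m'.+1) (- Posz m'.+1); rewrite subrr f0.
have tI : injective (exprz t) by move=> a b; rewrite -!fE; apply: fI.
have GammaE : Gamma = (fun x => exists a : int, x = exprz t a).
  apply/funext => x; apply/propext; split=> [/fS[a <-]|[a ->]]; first by exists a.
  by rewrite -fE; apply: fGamma.
have GammaP x : Gamma x <-> exists a : int, x = exprz t a.
  by rewrite GammaE.
have [b bP] : exists b : 'M[CC]_n.+1 -> bool, forall x y, M x -> M y -> b x = b y ->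
    GRing.comm (x^-1 * y) t.
  apply: centralizer_coloring => // x Mx; apply/GammaP.
  exact: (Gammanorm x t Mx Gt).
pose M0 x := M x /\ forall z, z = t -> GRing.comm z x.
have M0G : unit_subgroup M0 by apply: centralizer_subgroup.
have M0t : M0 t by split; [apply: GammaM | move=> z ->].
have M0C x : M0 x -> GRing.comm x t by move=> [_ xt]; apply/commr_sym/xt.
have [k [g gT]] : exists k (g : 'I_k -> 'M[CC]_n.+1),
    transversal M0 (fun x => exists a : int, x = exprz t a) g.
  have [_ h_cover] := hM; have [i0 _] := h_cover _ M1.
  have /choice[i iP] x : exists i, M x -> Gamma ((h i)^-1 * x).
    have [/h_cover[i [hi _]]|nM] := pselect (M x); first by exists i.
    by exists i0 => /nM.
  have iG x y : M0 x -> M0 y -> i x = i y -> Gamma (x^-1 * y).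
    move=> [Mx _] [My _] ixy.
    have : Gamma (((h (i x))^-1 * x)^-1 * ((h (i y))^-1 * y)).
      exact: GM (GV _ (iP x Mx)) (iP y My).
    have hU : h (i x) \is a GRing.unit by apply: MU; apply: hM.1.
    rewrite -ixy invrM ?unitrV //; last exact: MU.
    by rewrite mulrA divrK ?unitrV.
  have [k [_ kT]] := coloring_transversal M0G GG iG.
  by exists k; rewrite -GammaE.
have [c' [S [SM0 SS c'P]]] := commuting_coloring cP M0G M0t tI M0C gT.
have [H [HG HM0 SH HZ HC]] := abelian_double_centralizer M0G SM0 SS.
have HM x : H x -> M x by move/HM0 => [].
have bM0 x y : M x -> M y -> b x = b y -> M0 (x^-1 * y).
  move=> Mx My bxy; split; first by apply: MMul => //; apply: MV.
  by move=> _ ->; apply/commr_sym/bP.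
have [d dP] := tower_coloring MG bM0 (fun x y Gx Gy cxy => SH _ (c'P x y Gx Gy cxy)).
have [k' [k'T [g' g'T]]] := coloring_transversal MG HG dP.
exists k'; split; last by rewrite ltnS.
have tzC x a : GRing.comm x t -> GRing.comm x (exprz t a).
  by move=> xt; case: a => m'; [|apply: commrV]; apply: commrX.
exists H; split.
- by split.
(* [Gamma] is central in [M0], so it lies in the double centralizer. *)
- move=> x Gx; have /GammaP[a xE] := Gx; apply: HZ.
    by split; [exact: GammaM | move=> z ->; rewrite xE; apply: tzC].
  by move=> y /M0C yt; rewrite xE; apply: tzC.
(* [H] itself is abelian, so its commutators equal 1. *)
- move=> x y Hx Hy; have [xU yU] := (MU _ (HM _ Hx), MU _ (HM _ Hy)).
  rewrite -mulmxA [x *m y](HC _ _ Hx Hy) -mulmxA mulKmx // mulVmx //.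
- by exists g'.
Qed.
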